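(* Let $r$ be a positive integer and $T=r^{5r^2}$. Then there exist a finite point set $\mathcal{P}\subset\mathbb{R}^2$ and a finite set $\mathcal{L}$ of lines in $\mathbb{R}^2$ such that every point of $\mathcal{P}$ lies on at least $r$ lines of $\mathcal{L}$, every line of $\mathcal{L}$ is intersected, at points of $\mathcal{P}$, by at most $T$ other lines of $\mathcal{L}$, and $\mathcal{L}$ cannot be decomposed into two covering systems, i.e., there is no partition $\mathcal{L}=\mathcal{L}_1\cup\mathcal{L}_2$ such that every point of $\mathcal{P}$ lies on a line of $\mathcal{L}_1$ and on a line of $\mathcal{L}_2$. *)

(* Defs.v *)
From Stdlib Require Import Reals List.
Import ListNotations.
Open Scope R_scope.

Definition point : Type := (R * R)%type.

Definition line : Type := point -> Prop.

Definition is_line (l : line) : Prop :=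
  exists a b c : R, (a <> 0 \/ b <> 0) /\
    forall p : point, l p <-> a * fst p + b * snd p = c.

Definition on_at_least (L : list line) (p : point) (r : nat) : Prop :=
  exists S : list line, NoDup S /\ incl S L /\ (r <= length S)%nat /\
    Forall (fun l => l p) S.

Definition meets_at_most (P : list point) (L : list line) (l : line) (T : nat) : Prop :=
  forall S : list line, NoDup S -> incl S L ->
    (forall l', In l' S -> l' <> l /\ exists p, In p P /\ l p /\ l' p) ->
    (length S <= T)%nat.

(* L splits into two covering systems of P: a partition L = L1 ∪ L2
   (given by a 2-colouring c, L1 = colour true, L2 = colour false)
   such that every point of P is on a line of L1 and on a line of L2. *)
Definition decomposable (P : list point) (L : list line) : Prop :=
  exists c : line -> bool,
    forall p, In p P ->
      (exists l, In l L /\ l p /\ c l = true) /\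
      (exists l, In l L /\ l p /\ c l = false).

(* Main.v *)
Require Import Defs.
From Stdlib Require Import Reals List Lra.
From mathcomp Require all_boot zify.

(** Dually, we look for a planar point set with a system of [r]-rich lines such
    that every 2-colouring of the points has a monochromatic line.  The points
    are sampled from a grid with [k] columns, the lines from the lines
    [b = s i + t] of slope [s < Dl], which have exactly one point in each column.
    A set occupying an eighth of the grid contains a positive proportion of the
    collinear [r]-tuples, so by the container method every set without [r]
    collinear points is, up to a small fingerprint, contained in one of few sets
    of density at most 1/8.  A 2-colouring of a random sample without
    monochromatic [r]-tuple would confine the sample to two such sets, that is to
    a quarter of the grid, and a union bound over the fingerprints excludes this.
    The density of the sample is chosen such that a point lies on boundedly many
    collinear [r]-tuples on average, whereas collinear [(r+1)]-tuples are
    negligible; the few points of large degree or on a line with [r+1] points are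
    deleted beforehand. *)

(* MathComp's notations on [nat] must not be in scope in [theorem2p5], where [<=]
   and [^] are those of the standard library. *)
Module IndecomposableLines.
Import all_boot zify.
Set Implicit Arguments.
Unset Strict Implicit.
Unset Printing Implicit Defensive.
Local Open Scope nat_scope.

(** * Hypergraph containers *)

Lemma divnn_pos d : 0 < d -> d %/ d = 1.
Proof. by rewrite divnn => ->. Qed.

Lemma card_bigcup_le (I T : finType) (P : {pred I}) (F : I -> {set T}) c :
  (forall i, i \in P -> #|F i| <= c) -> #|\bigcup_(i in P) F i| <= #|P| * c.
Proof.
move=> leF; rewrite -sum_nat_const.
elim/big_rec2: _ => [|i s U Pi le_s]; first by rewrite cards0.
by apply: leq_trans (leq_card_setU _ _) _; apply: leq_add (leF i Pi) le_s.
Qed.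

(** * Edges and degrees of a hypergraph inside a set of points *)

Section EdgeCounts.
Variable X : finType.
Implicit Types (A e : {set X}) (E : {set {set X}}).

Definition edges_in E A := [set e in E | e \subset A].
Definition deg E A x := #|[set e in edges_in E A | x \in e]|.

Lemma edges_inP E A e : reflect (e \in E /\ e \subset A) (e \in edges_in E A).
Proof. by rewrite inE; apply: andP. Qed.

Lemma sum_deg E A s : (forall e, e \in E -> #|e| = s) ->
  \sum_(x in A) deg E A x = s * #|edges_in E A|.
Proof.
move=> Es; rewrite (eq_bigr (fun x => \sum_(e in edges_in E A | x \in e) 1)); last first.
  by move=> x _; rewrite sum1dep_card /deg; apply: eq_card => e; rewrite !inE.
rewrite (exchange_big_dep (mem (edges_in E A))) /=; last by move=> x e _ /andP[].
rewrite (eq_bigr (fun => s)); first by rewrite sum_nat_const mulnC.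
move=> e /edges_inP[eE eA]; rewrite sum1dep_card -(Es e eE); apply: eq_card => x.
rewrite !inE eE eA /=; case xe: (x \in e); rewrite ?andbF ?andbT //.
exact: (subsetP eA).
Qed.

Lemma card_edges_inD1 E A x :
  #|edges_in E A| = #|edges_in E (A :\ x)| + deg E A x.
Proof.
rewrite -(cardsID [set e : {set X} | x \in e] (edges_in E A)) addnC; congr (_ + _).
  by apply: eq_card => e; rewrite !inE subsetD1 [RHS]andbA andbC.
by apply: eq_card => e; rewrite !inE.
Qed.

Lemma deg_subset E A A' x : A' \subset A -> deg E A' x <= deg E A x.
Proof.
move=> sA; apply/subset_leq_card/subsetP => e; rewrite !inE => /andP[/andP[-> eA] ->].
by rewrite (subset_trans eA sA).
Qed.

(** Deleting the points of [A] one at a time destroys at most [D] edges per step, and no nonempty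
    edge survives in the empty set. *)
Lemma card_edges_in_le E A D : (forall e, e \in E -> 0 < #|e|) ->
  (forall x, deg E A x <= D) -> #|edges_in E A| <= #|A| * D.
Proof.
elim: {A}_.+1 {-2}A (ltnSn #|A|) => // N IH A ltA E0 dE.
have [->|[x xA]] := set_0Vmem A.
  rewrite cards0 leqn0 cards_eq0; apply/eqP/setP => e; rewrite !inE subset0.
  by apply/negbTE/negP => /andP[/E0 + /eqP e0]; rewrite e0 cards0.
rewrite (card_edges_inD1 _ _ x) (cardsD1 x A) xA mulnDl mul1n addnC leq_add //.
apply: IH => //; first by move: ltA; rewrite (cardsD1 x A) xA.
by move=> y; apply: leq_trans (dE y); apply/deg_subset/subD1set.
Qed.
End EdgeCounts.

(** * The container algorithm *)

Section Containers.
Variables (X : finType) (E : {set {set X}}) (r k : nat) (D th h : nat -> nat).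
Hypothesis r_gt1 : 1 < r.
Hypothesis E_unif : forall e, e \in E -> #|e| = r.
Hypothesis E_deg : forall x, deg E setT x <= D 0.
Hypothesis E_codeg : forall x y, x != y ->
  #|[set z | [exists e in E, [&& x \in e, y \in e & z \in e]]]| <= k.
Hypothesis D_last : D r.-1 = 1.
Hypothesis h_gt0 : forall j, j < r.-1 -> 0 < h j.
Hypothesis th_gt0 : forall j, j < r.-1 -> 0 < th j.
Hypothesis th_le : forall j, j < r.-1 -> 4 * h j * th j <= D j.
Hypothesis D_step : forall j, j < r.-1 -> 4 * h j * (k * D j.+1) <= D j.
Hypothesis h_step : forall j, j < r.-1 -> h j.+1 = 4 * r.-1 * h j.
Hypothesis D_large : forall i, 0 < i < r.-1 -> 2 * 2 ^ k <= D i.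
Implicit Types (A S F e : {set X}) (Es : nat -> {set {set X}}).

(* A state consists of the set A of points not yet decided and of hypergraphs
   [Es i], [i < r]: the edges of [Es i] have [r - i] points and become edges of
   [E] when points put into the fingerprint are added.  Degrees are only counted
   inside A, and are kept below [D i]. *)
Record valid A Es : Prop := Valid {
  valid0 : Es 0 = E;
  valid_card : forall i e, i < r -> e \in Es i -> #|e| = r - i;
  valid_sub : forall i e, i < r -> e \in Es i -> exists2 e0, e0 \in E & e \subset e0;
  valid_deg : forall i x, i < r -> deg (Es i) A x <= D i }.

(** Edges are added only through points below half of the degree bound; the other half leaves room
    for everything one step can add. *)
Definition saturated A Es i y := D i <= 2 * deg (Es i) A y.
Definition new_edges A Es j x := [set e' : {set X} |
  [&& x \notin e', x |: e' \in edges_in (Es j) A, e' \notin Es j.+1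
    & [forall y in e', ~~ saturated A Es j.+1 y]]].
(* Putting [x] into the fingerprint adds [new_edges A Es j x] to [Es j.+1].  This
   happens at most [budget] times: deleting a point from A does not increase
   [#|A| * D i - #|edges_in (Es i) A|], adding [th j] edges decreases it. *)
Definition budget A Es :=
  \sum_(j < r.-1) (#|A| * D j.+1 - #|edges_in (Es j.+1) A|) %/ th j.

Lemma valid_subset A A' Es : A' \subset A -> valid A Es -> valid A' Es.
Proof.
move=> sA [w0 wc ws wd]; split=> // i x ir.
by apply: leq_trans (wd i x ir); apply: deg_subset.
Qed.

Lemma valid_card_edges A Es i : valid A Es -> i < r -> #|edges_in (Es i) A| <= #|A| * D i.
Proof.
move=> w ir; apply: card_edges_in_le => [e|x]; last exact: valid_deg.
by move=> /(valid_card w ir) ->; lia.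
Qed.

Lemma budget_D1_term A Es x i : valid A Es -> x \in A -> i < r ->
  #|A :\ x| * D i - #|edges_in (Es i) (A :\ x)| <= #|A| * D i - #|edges_in (Es i) A|.
Proof.
move=> w xA ir; have := valid_deg w x ir.
rewrite (card_edges_inD1 (Es i) A x) (cardsD1 x A) xA mulnDl mul1n; lia.
Qed.

Lemma budget_D1 A Es x : valid A Es -> x \in A -> budget (A :\ x) Es <= budget A Es.
Proof.
move=> w xA; apply: leq_sum => j _; apply: leq_div2r.
by apply: budget_D1_term => //; have := ltn_ord j; lia.
Qed.

Definition add_edges A Es j x i := if i == j.+1 then Es i :|: new_edges A Es j x else Es i.

(** Such an edge is contained in an edge of [E] through [x] and [y], hence is a subset of the at
    most [k] points sharing an edge with both. *)
Lemma card_new_edges_pair A Es j x y : valid A Es -> j < r -> x != y ->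
  #|[set e in new_edges A Es j x | y \in e]| <= 2 ^ k.
Proof.
move=> w jr xy; set Z := [set z | [exists e in E, [&& x \in e, y \in e & z \in e]]].
apply: leq_trans (leq_pexp2l _ (E_codeg xy)) => //.
rewrite -card_powerset; apply/subset_leq_card/subsetP => e; rewrite !inE.
move=> /andP[/and4P[_ /andP[eE _] _ _] ye].
have [e0 e0E /subsetP se] := valid_sub w jr eE.
apply/subsetP => z ze; rewrite inE; apply/existsP; exists e0; rewrite e0E.
by rewrite !se // !inE ?eqxx ?ye ?ze ?orbT.
Qed.

Lemma valid_add A Es j x : valid A Es -> j < r.-1 -> valid (A :\ x) (add_edges A Es j x).
Proof.
move=> w jr; have jr' : j < r by lia.
split.
- by rewrite /add_edges /= (valid0 w).
- move=> i e ir; rewrite /add_edges; case: eqP => [ij|_]; last exact: (valid_card w).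
  rewrite inE => /orP[|]; first exact: (valid_card w).
  rewrite !inE => /and4P[xe /andP[/(valid_card w jr')]].
  by rewrite cardsU1 xe => + _ _ _; lia.
- move=> i e ir; rewrite /add_edges; case: eqP => [ij|_]; last exact: (valid_sub w).
  rewrite inE => /orP[|]; first exact: (valid_sub w).
  rewrite !inE => /and4P[xe /andP[/(valid_sub w jr')[e0 e0E se]] _ _ _].
  by exists e0 => //; apply: subset_trans se; apply: subsetUr.
move=> i y ir; rewrite /add_edges; case: eqP => [ij|_]; last first.
  by apply: leq_trans (valid_deg w y ir); apply/deg_subset/subD1set.
set c := #|[set e in new_edges A Es j x | y \in e]|.
have le_deg : deg (Es i :|: new_edges A Es j x) (A :\ x) y <= deg (Es i) A y + c.
  apply: leq_trans (leq_card_setU _ _); apply/subset_leq_card/subsetP => e.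
  rewrite inE => /andP[/edges_inP[/setUP[eE|eC] eA] ye].
    by rewrite !inE eE ye (subset_trans eA (subD1set _ _)).
  by rewrite inE; apply/orP; right; rewrite inE eC ye.
apply: leq_trans le_deg _.
have [->|] := posnP c; first by rewrite addn0; apply: valid_deg.
rewrite /c => /card_gt0P[e]; rewrite inE => /andP[]; rewrite inE.
move=> /and4P[xe eE eN /forall_inP ns] ye.
have {ns} := ns y ye; rewrite /saturated -ij -ltnNge => ns.
have xy : x != y by apply: contraNneq xe => ->.
(* On the last level edges are singletons: an unsaturated [y] has degree 0 and gains at most one
   edge. On the other levels the old degree is below [D i / 2], and at most [2 ^ k <= D i / 2] edges
   are new. *)
have [ilast|iN] := eqVneq i r.-1.
  move: ns; rewrite ilast D_last => ns.
  suff: c <= 1 by lia.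
  rewrite -(cards1 [set y]); apply/subset_leq_card/subsetP => e'; rewrite !inE.
  move=> /andP[/and4P[xe' /andP[/(valid_card w jr') + _] _ _]].
  rewrite cardsU1 xe' => ce ye'; rewrite eq_sym eqEcard sub1set ye' cards1; lia.
have := card_new_edges_pair w jr' xy; rewrite -/c.
have /D_large : 0 < i < r.-1 by lia.
lia.
Qed.

Lemma budget_add A Es j x : valid A Es -> x \in A -> j < r.-1 -> th j <= #|new_edges A Es j x| ->
  budget (A :\ x) (add_edges A Es j x) < budget A Es.
Proof.
move=> w xA jr thc; rewrite /budget (bigD1 (Ordinal jr)) //= [ltnRHS](bigD1 (Ordinal jr)) //=.
rewrite -addSn leq_add //; last first.
  apply: leq_sum => i; rewrite -val_eqE /= => ij; rewrite /add_edges eqSS (negbTE ij).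
  by apply/leq_div2r/budget_D1_term => //; have := ltn_ord i; lia.
have jr' : j.+1 < r by lia.
have w' := valid_add x w jr.
(* Validity of the new state shows that the truncated difference does not stop at 0: the new edges
   are disjoint from the old ones and still fit below [#|A :\ x| * D j.+1], so the quotient drops by
   at least 1. *)
have := valid_card_edges w' jr'; rewrite {1 2}/add_edges eqxx.
have -> : #|edges_in (Es j.+1 :|: new_edges A Es j x) (A :\ x)|
       = #|edges_in (Es j.+1) (A :\ x)| + #|new_edges A Es j x|.
  rewrite -cardsUI [X in _ + X](_ : _ = 0) ?addn0; last first.
    apply/eqP; rewrite cards_eq0; apply/eqP/setP => e; rewrite !inE.
    by case: (e \in Es j.+1); rewrite ?andbF ?andFb.
  apply: eq_card => e; apply/edges_inP/setUP => [[/setUP[eE|eC] eA]|[/edges_inP[eE eA]|eC]].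
  - by left; apply/edges_inP.
  - by right.
  - by split=> //; apply/setUP; left.
  split; first by apply/setUP; right.
  move: eC; rewrite inE => /and4P[xe /edges_inP[_]].
  by rewrite subUset subsetD1 => /andP[_ ->] _ _.
have := budget_D1_term w xA jr'.
set a := #|A :\ x| * _; set a' := #|A| * _ => le1 le2.
rewrite -addn1 -[X in _ + X](divnn_pos (th_gt0 jr)) -divnDr ?dvdnn //.
apply: leq_div2r; move: thc le1 le2;
move: #|new_edges A Es j x| #|edges_in _ (A :\ x)| #|edges_in _ A| => c u v.
by clearbody a a'; lia.
Qed.

(* If adding any point of A creates few new edges, then most edges of [Es j] in A
   contain a saturated point of [Es j.+1], so that [Es j.+1] is dense in A too. *)
Lemma terminal_step A Es j : valid A Es -> j < r.-1 ->
    (forall x, x \in A -> [set x] \notin Es r.-1) ->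
    (forall x, x \in A -> #|new_edges A Es j x| <= th j) ->
  #|X| * D j <= #|edges_in (Es j) A| * h j ->
  #|X| * D j.+1 <= #|edges_in (Es j.+1) A| * h j.+1.
Proof.
move=> w jr noforb nouse many; have jr' : j < r by lia.
have j1r : j.+1 < r by lia.
set U := [set y in A | saturated A Es j.+1 y].
set Z := \bigcup_(y in U) [set e in edges_in (Es j) A | y \in e].
set C := \bigcup_(x in A) [set x |: e' | e' in new_edges A Es j x].
set Ext := fun e' : {set X} => [set x | (x \notin e') && (x |: e' \in Es j)].
set W := \bigcup_(e' in edges_in (Es j.+1) A) [set x |: e' | x in Ext e'].
(* An edge meets [U], or else removing one of its points [x] leaves a set that is already in
   [Es j.+1] (then it is in [W]) or is a new edge for [x] (then it is in [C]). *)
have cover : edges_in (Es j) A \subset Z :|: C :|: W.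
  apply/subsetP => e eEA; have [eE eA] := edges_inP _ _ _ eEA.
  have /card_gt0P[x xe] : 0 < #|e| by rewrite (valid_card w jr' eE); lia.
  have [eU|/exists_inPn eU] := boolP [exists y in e, y \in U].
    have [y ye yU] := exists_inP eU.
    by rewrite !in_setU; apply/orP; left; apply/orP; left; apply/bigcupP; exists y => //; rewrite inE eEA.
  have ex : x |: e :\ x = e by apply: setD1K.
  have [e'E|e'E] := boolP (e :\ x \in Es j.+1).
    rewrite in_setU; apply/orP; right; apply/bigcupP; exists (e :\ x).
      by apply/edges_inP; split => //; apply: subset_trans eA; apply: subD1set.
    by apply/imsetP; exists x => //; rewrite inE ex eE !inE eqxx.
  rewrite !in_setU; apply/orP; left; apply/orP; right; apply/bigcupP; exists x; first exact: (subsetP eA).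
  apply/imsetP; exists (e :\ x) => //; rewrite inE ex eEA e'E !inE eqxx /=.
  apply/forall_inP => y; rewrite inE => /andP[_ ye].
  by have := eU y ye; rewrite inE (subsetP eA).
have cardZ : #|Z| <= #|U| * D j.
  by apply: card_bigcup_le => y _; apply: (valid_deg w).
have cardC : #|C| <= #|A| * th j.
  by apply: card_bigcup_le => x xA; apply: leq_trans (nouse x xA); apply: leq_imset_card.
have cardW : #|W| <= #|edges_in (Es j.+1) A| * k.
  apply: card_bigcup_le => e' /edges_inP[e'E e'A]; apply: leq_trans (leq_imset_card _ _) _.
  have ce' := valid_card w j1r e'E.
  (* A singleton [e'] would be an edge of the last level inside [A], which is excluded; two points
     of [e'] leave at most [k] choices for [x]. *)
  have [small|/card_gt1P[y [z [ye' ze' yz]]]] := leqP #|e'| 1.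
    have /eqP/cards1P[y e'y] : #|e'| = 1 by lia.
    have yA : y \in A by apply: (subsetP e'A); rewrite e'y set11.
    have rj : r.-1 = j.+1 by lia.
    by have := noforb y yA; rewrite -e'y rj e'E.
  apply: leq_trans (E_codeg yz); apply/subset_leq_card/subsetP => x.
  rewrite !inE => /andP[_ /(valid_sub w jr')[e0 e0E /subsetP se]].
  apply/existsP; exists e0; rewrite e0E.
  by rewrite !se // !inE ?eqxx ?ye' ?ze' ?orbT.
have cardE := valid_card_edges w j1r.
have cardAX : #|A| <= #|X| by apply: max_card.
have le1 : #|edges_in (Es j) A| <= #|U| * D j + #|X| * th j + #|X| * (k * D j.+1).
  apply: leq_trans (subset_leq_card cover) _.
  apply: leq_trans (leq_card_setU _ _) _; apply: leq_add.
    apply: leq_trans (leq_card_setU _ _) _; apply: leq_add => //.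
    by apply: leq_trans cardC _; rewrite leq_mul2r cardAX orbT.
  apply: leq_trans cardW _; rewrite [k * _]mulnC mulnA leq_mul2r; apply/orP; right.
  by apply: leq_trans cardE _; rewrite leq_mul2r cardAX orbT.
have Dj : 0 < D j.
  by apply: leq_trans (th_le jr); rewrite !muln_gt0 h_gt0 ?th_gt0.
(* [C] and [W] each account for at most a quarter of the assumed edge count, so at least half of it
   falls to the edges meeting [U]. *)
have le2 : #|X| <= 2 * h j * #|U|.
  rewrite -(leq_pmul2r Dj).
  have l3 : #|X| * (4 * h j * th j) <= #|X| * D j by rewrite leq_mul2l th_le ?orbT.
  have l4 : #|X| * (4 * h j * (k * D j.+1)) <= #|X| * D j by rewrite leq_mul2l D_step ?orbT.
  have l5 : #|edges_in (Es j) A| * h j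
     <= (#|U| * D j + #|X| * th j + #|X| * (k * D j.+1)) * h j by rewrite leq_mul2r le1 orbT.
  nia.
(* Saturated points have degree at least [D j.+1 / 2], while the degrees sum to [r - j.+1] times the
   number of edges. *)
have le3 : #|U| * D j.+1 <= 2 * (r.-1 * #|edges_in (Es j.+1) A|).
  have -> : 2 * (r.-1 * #|edges_in (Es j.+1) A|)
    = \sum_(x in A) 2 * deg (Es j.+1) A x + 2 * (j * #|edges_in (Es j.+1) A|).
    rewrite -big_distrr /= (@sum_deg _ _ _ (r - j.+1)); last by move=> e; apply: (valid_card w).
    rewrite -mulnDr -mulnDl; congr (2 * (_ * _)); lia.
  apply: leq_trans (leq_addr _ _); rewrite -sum_nat_const.
  rewrite [leqRHS](bigID (mem U)) /=; apply: leq_trans (leq_addr _ _).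
  rewrite [leqRHS](eq_bigl (mem U)) /=; last by move=> x; rewrite !inE andbA andbb.
  by apply: leq_sum => y; rewrite inE => /andP[_].
rewrite h_step //.
have := leq_mul le2 (leqnn (D j.+1)).
have := leq_mul (leqnn (2 * h j)) le3.
nia.
Qed.

(** Otherwise density propagates by [terminal_step] to level [r.-1], where it yields a singleton
    edge inside [A]. *)
Lemma terminal_sparse A Es : 0 < #|X| -> valid A Es ->
    (forall x, x \in A -> [set x] \notin Es r.-1) ->
    (forall j x, j < r.-1 -> x \in A -> #|new_edges A Es j x| <= th j) ->
  #|edges_in E A| * h 0 < #|X| * D 0.
Proof.
move=> X0 w noforb nouse; rewrite ltnNge; apply/negP => many.
suff: forall j, j <= r.-1 -> #|X| * D j <= #|edges_in (Es j) A| * h j.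
  move=> /(_ r.-1 (leqnn _)); rewrite D_last muln1 => /(leq_trans X0).
  rewrite muln_gt0 => /andP[/card_gt0P[e /edges_inP[eE eA]] _].
  have ce := valid_card w (ltac:(lia) : r.-1 < r) eE.
  have /eqP/cards1P[x ex] : #|e| = 1 by lia.
  have xA : x \in A by apply: (subsetP eA); rewrite ex set11.
  by have := noforb x xA; rewrite -ex eE.
elim=> [_|j IH jr]; first by rewrite (valid0 w).
by apply: terminal_step => // [x xA|]; [apply: nouse | apply: IH; lia].
Qed.

(** Induction on [#|A|]. The container depends on [F] alone: at a branching point [x], membership of
    [x] in [F] tells which branch was taken for [S], so the run can be replayed without knowing
    [S]. *)
Lemma container_state A Es : 0 < #|X| -> valid A Es ->
  exists2 C : {set X} -> {set X},
    (forall F, #|edges_in E (C F)| * h 0 < #|X| * D 0) &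
    (forall S, (forall i e, i < r -> e \in Es i -> ~~ (e \subset S)) ->
      exists F, [/\ F \subset S :&: A, #|F| <= budget A Es & S :&: A \subset F :|: C F]).
Proof.
move=> X0; elim: {A}_.+1 {-2}A (ltnSn #|A|) Es => // N IH A ltA Es w.
have ltA' x : x \in A -> #|A :\ x| < N.
  by move=> xA; move: ltA; rewrite (cardsD1 x A) xA.
(* A point that is itself an edge cannot belong to [S] and is dropped. *)
have [/exists_inP[x xA xforb]|/exists_inPn noforb] :=
    boolP [exists x in A, [set x] \in Es r.-1].
  have [C C1 C2] := IH _ (ltA' x xA) Es (valid_subset (subD1set _ _) w).
  exists C => // S SI; have [F [FS bF SF]] := C2 S SI.
  have xS : x \notin S.
    by have := SI r.-1 _ _ xforb; rewrite sub1set; apply; lia.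
  have SA : S :&: (A :\ x) = S :&: A.
    apply/setP => y; rewrite !inE; case: eqP => // ->; rewrite (negbTE xS) //=.
  exists F; rewrite -SA; split=> //; apply: leq_trans bF _; exact: budget_D1.
(* A point producing many new edges joins the fingerprint if it is in [S], and is dropped
   otherwise. *)
have [/exists_inP[x xA /existsP[j use]]|/exists_inPn nouse] :=
    boolP [exists x in A, [exists j : 'I_r.-1, th j < #|new_edges A Es j x|]].
  have jr := ltn_ord j; have wno := valid_subset (subD1set A x) w.
  have [C C1 C2] := IH _ (ltA' x xA) Es wno.
  have [C' C1' C2'] := IH _ (ltA' x xA) _ (valid_add x w jr).
  exists (fun F => if x \in F then C' (F :\ x) else C F) => [F|S SI].
    by case: ifP.
  have [xS|xS] := boolP (x \in S); last first.
    have [F [FS bF SF]] := C2 S SI.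
    have SA : S :&: (A :\ x) = S :&: A.
      by apply/setP => y; rewrite !inE; case: eqP => // ->; rewrite (negbTE xS).
    have xF : x \in F = false.
      by apply/negbTE; apply: contra xS => /(subsetP FS); rewrite inE => /andP[].
    exists F; rewrite xF -SA; split=> //; apply: leq_trans bF _; exact: budget_D1.
  (* A new edge inside [S] would, together with [x], form an edge of [Es j] inside [S]. *)
  have SI' i e : i < r -> e \in add_edges A Es j x i -> ~~ (e \subset S).
    move=> ir; rewrite /add_edges; case: eqP => _; last exact: SI.
    move=> /setUP[|]; first exact: SI.
    rewrite inE => /and4P[_ /edges_inP[eE _] _ _].
    have := SI j _ (ltac:(lia)) eE; apply: contra => eS.
    by rewrite subUset sub1set xS.
  have [F [FS bF SF]] := C2' S SI'.
  have xF : x \notin F.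
    by apply/negP => /(subsetP FS); rewrite !inE eqxx andbF.
  exists (x |: F); rewrite setU11 setU1K //; split.
  - rewrite subUset sub1set inE xS xA /=; apply: subset_trans FS _.
    by apply: setIS; apply: subD1set.
  - by rewrite cardsU1 xF add1n; apply: leq_ltn_trans bF _; apply: budget_add => //; apply: ltnW.
  apply/subsetP => y yS; have [->|yx] := eqVneq y x; first by rewrite !inE eqxx.
  have /(subsetP SF) : y \in S :&: (A :\ x) by move: yS; rewrite !inE yx.
  by rewrite !inE => /orP[->|->]; rewrite !orbT.
(* No useful point is left: [A] itself is the container. *)
exists (fun => A) => [_|S SI].
  apply: (terminal_sparse X0 w) => // j x jr xA.
  have := nouse x xA; apply: contraR; rewrite -ltnNge => lt.
  by apply/existsP; exists (Ordinal jr).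
by exists set0; rewrite sub0set cards0 set0U subsetIr.
Qed.

Lemma containers : 0 < #|X| ->
  exists2 C : {set X} -> {set X},
    (forall F, #|edges_in E (C F)| * h 0 < #|X| * D 0) &
    (forall S, (forall e, e \in E -> ~~ (e \subset S)) ->
      exists F, [/\ F \subset S, #|F| <= \sum_(j < r.-1) (#|X| * D j.+1) %/ th j
                 & S \subset F :|: C F]).
Proof.
move=> X0; pose Es i := if i == 0 then E else set0.
have w : valid setT Es.
  split=> // -[|i] e //=; rewrite ?inE //.
  - by rewrite subn0 => _ /E_unif.
  - by exists e.
  by move=> _; rewrite /deg (_ : [set _ in _ | _] = set0) ?cards0 //; apply/setP => f; rewrite !inE.
have [C C1 C2] := container_state X0 w; exists C => // S SI.
have [|F [FS bF SF]] := C2 S; first by move=> [|i] e _ /=; [apply: SI | rewrite inE].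
exists F; split.
- by apply: subset_trans FS _; apply: subsetIl.
- apply: leq_trans bF _; apply: leq_sum => j _; apply: leq_div2r.
  by rewrite cardsT leq_subr.
by move: SF; rewrite setIT.
Qed.
End Containers.

(** * Random point sequences *)

Lemma leq_expl a b e : a <= b -> a ^ e <= b ^ e.
Proof. by case: e => // e ab; rewrite leq_exp2r. Qed.

Lemma exists_subset_card (T : finType) (A : {set T}) s :
  s <= #|A| -> exists2 B : {set T}, B \subset A & #|B| = s.
Proof.
move=> sA; exists [set x in take s (enum A)].
  by apply/subsetP => x; rewrite inE => /mem_take; rewrite mem_enum.
by rewrite cardsE (card_uniqP _) ?take_uniq ?enum_uniq // size_takel // -cardE.
Qed.

Lemma card_small_sets_sum m a :
  #|[set J : {set 'I_m} | #|J| <= a]| <= \sum_(i < a.+1) 'C(m, i).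
Proof.
rewrite (_ : [set J | _] = \bigcup_(i : 'I_a.+1) [set J : {set 'I_m} | #|J| == i]).
  elim/big_rec2: _ => [|i s U _ le_s]; first by rewrite cards0.
  apply: leq_trans (leq_card_setU _ _) _; apply: leq_add le_s.
  by rewrite card_draws card_ord.
apply/setP => J; rewrite inE; apply/idP/bigcupP => [leJ|[i _]].
  by exists (Ordinal (ltac:(lia) : #|J| < a.+1)); rewrite // inE.
by rewrite inE => /eqP ->; have := ltn_ord i; lia.
Qed.

(* A set J of size at most a has weight at least s^(-a) when sets are weighted
   by s^(-#|J|), and the weights sum up to (1 + 1/s)^(s a). *)
Lemma card_small_sets s a : 0 < s -> s.+1 ^ s <= 4 * s ^ s ->
  #|[set J : {set 'I_(s * a)} | #|J| <= a]| <= (4 * s) ^ a.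
Proof.
move=> s0 le_s; set m := s * a; apply: leq_trans (card_small_sets_sum _ _) _.
have am : a <= m by rewrite leq_pmull.
rewrite -(@leq_pmul2r (s ^ (m - a))) ?expn_gt0 ?s0 //.
apply: (@leq_trans (s.+1 ^ m)).
  rewrite -[s.+1]addn1 expnDn big_distrl /=.
  rewrite (big_ord_widen m.+1 (fun i => 'C(m, i) * s ^ (m - a))) //.
  rewrite big_mkcond; apply: leq_sum => i _; case: ifP => // ia.
  by rewrite exp1n muln1 leq_mul2l leq_pexp2l ?orbT //; lia.
rewrite expnMn -mulnA -expnD subnKC // /m !expnM -expnMn.
exact: leq_expl.
Qed.

Lemma card_notin m (J : {set 'I_m}) : #|fun i => i \notin J| = m - #|J|.
Proof. by have := cardC (mem J); rewrite card_ord => /(canRL (addKn _)). Qed.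

Section RandomPoints.
Variables (X Lf : finType) (pts : Lf -> {set X}) (k B r m : nat).
Hypothesis card_pts : forall l, #|pts l| = k.
Hypothesis cardX : #|X| = k * B.
Implicit Types (v u : {ffun 'I_m -> X}) (J : {set 'I_m}).

Lemma card_ffun_agree J (u : 'I_m -> X) (W : {set X}) :
  #|[set v : {ffun 'I_m -> X} | [forall i, if i \in J then v i == u i else v i \in W]]|
    = #|W| ^ (m - #|J|).
Proof.
pose F i := if i \in J then [set u i] else W.
rewrite (_ : #|_| = #|family (fun i => mem (F i))|); last first.
  apply: eq_card => v; rewrite inE; apply: eq_forallb => i.
  by rewrite -[RHS]/(v i \in F i) /F; case: ifP; rewrite ?inE.
rewrite card_family foldrE big_image /= (bigID (mem J)) /=.
rewrite big1 ?mul1n; last by move=> i iJ; rewrite /F iJ cards1.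
rewrite (eq_bigr (fun => #|W|)); last by move=> i /negbTE iJ; rewrite /F iJ.
rewrite prod_nat_const; congr (_ ^ _).
exact: card_notin.
Qed.

Lemma card_ffun_on J (W : {set X}) :
  #|[set v : {ffun 'I_m -> X} | [forall i in J, v i \in W]]|
    = #|W| ^ #|J| * #|X| ^ (m - #|J|).
Proof.
rewrite (_ : #|_| = #|family (fun i => mem (if i \in J then W else setT))|); last first.
  apply: eq_card => v; rewrite inE; apply: eq_forallb => i.
  by rewrite -[RHS]/(v i \in if i \in J then W else setT); case: ifP; rewrite ?inE.
rewrite card_family foldrE big_image /= (bigID (mem J)) /=.
rewrite (eq_bigr (fun => #|W|)); last by move=> i ->.
rewrite prod_nat_const; congr (_ * _).
rewrite (eq_bigr (fun => #|X|)); last by move=> i /negbTE ->; rewrite cardsT.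
rewrite prod_nat_const; congr (_ ^ _).
exact: card_notin.
Qed.

(** Sets of indices rather than of points, so that repeated sample points need no special
    treatment. *)
Definition rich_sets q v :=
  [set p : Lf * {set 'I_m} | (#|p.2| == q) && [forall i in p.2, v i \in pts p.1]].

(** An expectation scaled by [(k * B) ^ m]: each of the [q] indices independently hits a given line
    with probability [1 / B]. *)
Lemma sum_rich_sets q : (\sum_v #|rich_sets q v|) * B ^ q = #|Lf| * 'C(m, q) * (k * B) ^ m.
Proof.
rewrite (eq_bigr (fun v => \sum_(p : Lf * {set 'I_m} |
    (#|p.2| == q) && [forall i in p.2, v i \in pts p.1]) 1)); last first.
  by move=> v _; rewrite sum1dep_card.
rewrite (exchange_big_dep (fun p : Lf * {set 'I_m} => #|p.2| == q)) /=; last by move=> ? ? _ /andP[].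
have -> : #|Lf| * 'C(m, q) * (k * B) ^ m = \sum_(p : Lf * {set 'I_m} | #|p.2| == q) (k * B) ^ m.
  rewrite sum_nat_const; congr (_ * _).
  rewrite -[m in 'C(m, _)]card_ord -card_draws -cardsT -cardsX.
  by apply: eq_card => p; rewrite !inE.
rewrite big_distrl /=; apply: eq_bigr => -[l J] /= /eqP cJ.
rewrite (eq_bigl (fun v : {ffun 'I_m -> X} => v \in
    [set v : {ffun 'I_m -> X} | [forall i in J, v i \in pts l]])); last first.
  by move=> v; rewrite inE cJ eqxx.
rewrite sum1_card card_ffun_on card_pts cardX cJ mulnAC -expnMn -expnD.
by rewrite subnKC // -cJ -[leqRHS]card_ord max_card.
Qed.

Definition pdeg v i := #|[set p in rich_sets r v | i \in p.2]|.

Lemma sum_pdeg v : \sum_i pdeg v i = r * #|rich_sets r v|.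
Proof.
rewrite (eq_bigr (fun i => \sum_(p in rich_sets r v | i \in p.2) 1)); last first.
  by move=> i _; rewrite sum1dep_card /pdeg; apply: eq_card => p; rewrite !inE.
rewrite (exchange_big_dep (mem (rich_sets r v))) /=; last by move=> i p _ /andP[].
rewrite (eq_bigr (fun => r)); first by rewrite sum_nat_const mulnC.
move=> p pI; transitivity #|p.2|; last by move: pI; rewrite inE => /andP[/eqP].
by rewrite sum1dep_card; apply: eq_card => i; rewrite inE pI.
Qed.

(** [D] takes one index from each rich set of size [r.+1] and all indices of degree above [T0]; by
    [sum_pdeg] there are at most [r * #|rich_sets r v| / T0] of the latter. *)
Lemma deletion v T0 b : 0 < T0 -> T0 * #|rich_sets r.+1 v| + r * #|rich_sets r v| <= b * T0 ->
  exists2 D : {set 'I_m}, #|D| <= b &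
    (forall i, i \notin D -> pdeg v i <= T0) /\
    (forall l, #|[set i | (i \notin D) && (v i \in pts l)]| <= r).
Proof.
move=> T00 le_b.
pose pk (p : Lf * {set 'I_m}) := if [pick i in p.2] is Some i then [set i] else set0.
pose D1 := \bigcup_(p in rich_sets r.+1 v) pk p; pose D2 := [set i | T0 < pdeg v i].
have cD1 : #|D1| <= #|rich_sets r.+1 v|.
  rewrite -[leqRHS]muln1; apply: card_bigcup_le => p _; rewrite /pk.
  by case: pickP => [i _|_]; rewrite ?cards1 ?cards0.
have cD2 : #|D2| * T0 <= r * #|rich_sets r v|.
  rewrite -sum_pdeg (bigID (mem D2)) /= -sum_nat_const.
  by apply: leq_trans (leq_addr _ _); apply: leq_sum => i; rewrite inE => /ltnW.
exists (D1 :|: D2).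
  rewrite -(leq_pmul2r T00); apply: leq_trans le_b.
  apply: (@leq_trans ((#|D1| + #|D2|) * T0)); first by rewrite leq_mul2r leq_card_setU orbT.
  by rewrite mulnDl leq_add // mulnC leq_mul2l cD1 orbT.
split=> [i|l]; first by rewrite !inE negb_or -leqNgt => /andP[].
rewrite leqNgt; apply/negP => /exists_subset_card[J /subsetP sJ cJ].
have JI : (l, J) \in rich_sets r.+1 v.
  by rewrite inE /= cJ eqxx; apply/forall_inP => i /sJ; rewrite inE => /andP[].
have : pk (l, J) \subset D1 by apply: (bigcup_sup (l, J)).
rewrite /pk; case: pickP => [i /= iJ|J0]; last first.
  by have /card_gt0P[i] : 0 < #|J| by [rewrite cJ]; rewrite J0.
rewrite sub1set => iD; have := sJ i iJ; rewrite inE => /andP[/negP[]].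
by rewrite inE iD.
Qed.

(* Double counting of the pairs of a captured v and a u that agrees with v on J:
   once u is fixed, v has [#|W u|] possible values at each position outside J. *)
Lemma card_captured (J : {set 'I_m}) (W : {ffun 'I_m -> X} -> {set X}) :
  (forall v u, {in J, v =1 u} -> W v = W u) -> (forall v, 4 * #|W v| <= #|X|) ->
  0 < #|X| ->
  #|[set v : {ffun 'I_m -> X} | [forall i, (i \in J) || (v i \in W v)]]| * 4 ^ (m - #|J|) <= #|X| ^ m.
Proof.
move=> W_loc W_small X0; set b := m - #|J|; set Bad := [set v | _].
rewrite -(@leq_pmul2r (#|X| ^ b)) ?expn_gt0 ?X0 // -mulnA -expnMn.
have -> : #|X| ^ m * #|X| ^ b = \sum_(u : {ffun 'I_m -> X}) #|X| ^ b.
  by rewrite sum_nat_const card_ffun card_ord.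
have cnt : #|Bad| * #|X| ^ b = \sum_(u : {ffun 'I_m -> X})
    #|[set v : {ffun 'I_m -> X} in Bad | [forall i, if i \in J then v i == u i else true]]|.
  rewrite [RHS](eq_bigr (fun u : {ffun 'I_m -> X} => \sum_(v : {ffun 'I_m -> X} |
      (v \in Bad) && [forall i, if i \in J then v i == u i else true]) 1)); last first.
    by move=> u _; rewrite sum1dep_card.
  rewrite (exchange_big_dep (mem Bad)) /=; last by move=> ? ? _ /andP[].
  rewrite -sum_nat_const; apply: eq_bigr => v vB.
  rewrite -cardsT -(card_ffun_agree J v) -sum1_card; apply: eq_bigl => u.
  by rewrite inE vB /=; apply: eq_forallb => i; rewrite inE eq_sym; case: ifP.
rewrite expnMn mulnCA mulnC cnt big_distrl; apply: leq_sum => u _.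
apply: (@leq_trans (#|W u| ^ b * 4 ^ b)); last by rewrite mulnC -expnMn leq_expl // W_small.
rewrite leq_mul2r -(card_ffun_agree J u (W u)); apply/orP; right.
apply/subset_leq_card/subsetP => v; rewrite !inE => /andP[/forallP vB /forallP vu].
have uv : {in J, v =1 u} by move=> i iJ; have := vu i; rewrite iJ => /eqP.
apply/forallP => i; case: ifP => iJ; first by have := vu i; rewrite iJ.
by have := vB i; rewrite iJ /= (W_loc _ _ uv).
Qed.
End RandomPoints.

Lemma pow65_le : 65 ^ 64 <= 4 * 64 ^ 64.
Proof. lia. Qed.

(** The deleted set [D] depends on the sample, so the union bound runs over all candidates for [D]
    as well as over the two fingerprints. *)
Lemma good_sample (X Lf : finType) (pts : Lf -> {set X}) k B r a T0 (C : {set X} -> {set X}) :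
    (forall l, #|pts l| = k) -> #|X| = k * B -> 0 < k -> 0 < B -> 0 < a -> 0 < T0 ->
    (forall F, 8 * #|C F| <= #|X|) ->
    #|Lf| * 'C(64 * a, r.+1) <= a * B ^ r.+1 ->
    r * (#|Lf| * 'C(64 * a, r)) <= T0 * a * B ^ r ->
  exists (v : {ffun 'I_(64 * a) -> X}) (D : {set 'I_(64 * a)}),
    [/\ forall i, i \notin D -> pdeg pts r v i <= T0,
        forall l, #|[set i | (i \notin D) && (v i \in pts l)]| <= r &
        forall J1 J2 : {set 'I_(64 * a)}, #|J1| <= a -> #|J2| <= a ->
          exists2 i, i \notin D :|: J1 :|: J2 & v i \notin C (v @: J1) :|: C (v @: J2)].
Proof.
move=> card_pts cardX k0 B0 a0 T00 C_small le2 le3; set m := 64 * a.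
have X0 : 0 < #|X| by rewrite cardX muln_gt0 k0.
pose N := #|X| ^ m; have N0 : 0 < N by rewrite expn_gt0 X0.
pose wt (v : {ffun 'I_m -> X}) := T0 * #|rich_sets pts r.+1 v| + r * #|rich_sets pts r v|.
pose Bad1 := [set v | 8 * a * T0 < wt v].
have le_wt : \sum_v wt v <= 2 * (T0 * a) * N.
  have s2 : \sum_v #|rich_sets pts r.+1 (v : {ffun 'I_m -> X})| <= a * N.
    rewrite -(@leq_pmul2r (B ^ r.+1)) ?expn_gt0 ?B0 //.
    by rewrite (sum_rich_sets _ card_pts cardX) -cardX -/N [leqRHS]mulnAC leq_mul2r le2 orbT.
  have s3 : r * \sum_v #|rich_sets pts r (v : {ffun 'I_m -> X})| <= T0 * a * N.
    rewrite -(@leq_pmul2r (B ^ r)) ?expn_gt0 ?B0 //.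
    by rewrite -[leqLHS]mulnA (sum_rich_sets _ card_pts cardX) -cardX -/N [leqLHS]mulnA
       [leqRHS]mulnAC leq_mul2r le3 orbT.
  rewrite /wt big_split /= -!big_distrr /=.
  rewrite -[leqRHS]mulnA mul2n -addnn leq_add //.
  by rewrite -[leqRHS]mulnA leq_mul2l s2 orbT.
(* Markov's inequality: the threshold in [Bad1] is four times the bound on the mean weight. *)
have bad1 : 4 * #|Bad1| <= N.
  have : 8 * a * T0 * #|Bad1| <= 2 * (T0 * a) * N.
    apply: leq_trans le_wt; rewrite mulnC -sum_nat_const [leqRHS](bigID (mem Bad1)) /=.
    by apply: leq_trans (leq_addr _ _); apply: leq_sum => v; rewrite inE => /ltnW.
  have -> : 8 * a * T0 * #|Bad1| = 2 * (T0 * a) * (4 * #|Bad1|) by lia.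
  by rewrite leq_pmul2l // !muln_gt0 T00.
pose Sm := [set J : {set 'I_m} | #|J| <= a].
pose Sm8 := [set J : {set 'I_m} | #|J| <= 8 * a].
pose W (p : {set 'I_m} * {set 'I_m} * {set 'I_m}) (v : {ffun 'I_m -> X}) :=
  C (v @: p.1.1) :|: C (v @: p.1.2).
pose JJ (p : {set 'I_m} * {set 'I_m} * {set 'I_m}) := p.2 :|: p.1.1 :|: p.1.2.
pose Bad2 := \bigcup_(p in setX (setX Sm Sm) Sm8)
  [set v : {ffun 'I_m -> X} | [forall i, (i \in JJ p) || (v i \in W p v)]].
(* Two containers fill at most a quarter of [X], and at least [64 * a - 10 * a] indices lie outside
   [JJ p]. *)
pose c := N %/ 4 ^ (54 * a).
have bad2' : #|Bad2| <= #|setX (setX Sm Sm) Sm8| * c.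
  apply: card_bigcup_le => p; rewrite !inE => /andP[/andP[p1 p2] p3].
  rewrite leq_divRL ?expn_gt0 //.
  have cJ : #|JJ p| <= 10 * a.
    rewrite (_ : 10 * a = 8 * a + a + a); last lia.
    apply: leq_trans (leq_card_setU _ _) (leq_add _ p2).
    exact: leq_trans (leq_card_setU _ _) (leq_add p3 p1).
  have cap : #|[set v : {ffun 'I_m -> X} | [forall i, (i \in JJ p) || (v i \in W p v)]]| * 4 ^ (m - #|JJ p|) <= N.
    apply: card_captured => // [v u uv|v].
      by congr (C _ :|: C _); apply: eq_in_imset => i ip; apply: uv; rewrite !inE ip !orbT.
    have W_le : #|W p v| <= #|C (v @: p.1.1)| + #|C (v @: p.1.2)| by apply: leq_card_setU.
    have := C_small (v @: p.1.1); have := C_small (v @: p.1.2); lia.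
  apply: leq_trans cap; rewrite leq_mul2l; apply/orP; right.
  rewrite leq_pexp2l // leq_subRL; last by apply: leq_trans cJ _; rewrite /m; lia.
  by move: cJ; move: #|_| => cJJ; rewrite /m; lia.
(* There are at most [2 ^ (80 * a)] triples, bounding the choices of [D] crudely by all subsets,
   against [4 ^ (54 * a) = 2 ^ (108 * a)]. *)
have bad2 : 4 * #|Bad2| <= N.
  have cSm : #|Sm| <= 2 ^ (8 * a).
    by rewrite expnM; apply: (card_small_sets a (isT : 0 < 64) pow65_le).
  have cSm8 : #|Sm8| <= 2 ^ (64 * a).
    by apply: leq_trans (max_card _) _; rewrite -cardsT -powersetT card_powerset cardsT card_ord.
  have cN : c * 4 ^ (54 * a) <= N by apply: leq_divM.
  have cP : #|setX (setX Sm Sm) Sm8| <= 2 ^ (80 * a).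
    rewrite !cardsX (_ : 80 * a = 8 * a + 8 * a + 64 * a); last lia.
    rewrite (expnD 2 (8 * a + 8 * a) (64 * a)) (expnD 2 (8 * a) (8 * a)).
    exact: leq_mul (leq_mul cSm cSm) cSm8.
  apply: leq_trans cN; rewrite mulnC.
  apply: (@leq_trans (2 ^ (80 * a) * c * 4)).
    by rewrite leq_mul2r /= (leq_trans bad2') // leq_mul2r cP orbT.
  rewrite mulnC mulnCA mulnC; rewrite [4 * _]mulnC -mulnA leq_mul2l; apply/orP; right.
  rewrite -[4]/(2 ^ 2) -expnM -expnD leq_pexp2l //; lia.
have [v vB] : exists v, v \notin Bad1 :|: Bad2.
  apply/existsP; rewrite -[X in is_true X]negbK; apply/negP => /existsPn all_bad.
  have : #|[set: {ffun 'I_m -> X}]| <= #|Bad1 :|: Bad2|.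
    by apply/subset_leq_card/subsetP => v _; apply/negbNE/all_bad.
  rewrite cardsT card_ffun card_ord -/N.
  move=> /leq_trans/(_ (leq_card_setU _ _)).
  by move: bad1 bad2 N0; move: #|Bad1| #|Bad2| (N) => b1 b2 n; lia.
move: vB; rewrite !inE negb_or -leqNgt => /andP[v1 v2].
have [D cD [D1 D2]] := deletion T00 v1.
exists v, D; split=> // J1 J2 cJ1 cJ2.
have [/exists_inP[i]|/exists_inPn none] :=
    boolP [exists i in ~: (D :|: J1 :|: J2), v i \notin C (v @: J1) :|: C (v @: J2)].
  by rewrite in_setC => iJ vi; exists i.
case/bigcupP: v2; exists (J1, J2, D); first by rewrite !inE cJ1 cJ2.
rewrite inE; apply/forallP => i; have [//|iJ] := boolP (i \in JJ _).
by have := none i; rewrite in_setC negbK; apply.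
Qed.

(** Replaces a fingerprint, a set of sampled points, by a set of indices that is no larger. *)
Lemma imset_preimage_card (I T : finType) (f : I -> T) (A : {set I}) (F : {set T}) :
  F \subset f @: A -> exists J : {set I}, f @: J = F /\ #|J| <= #|F|.
Proof.
move=> /subsetP sF; have [->|[x0 x0F]] := set_0Vmem F.
  by exists set0; rewrite imset0 !cards0.
have /imsetP[i0 _ _] := sF x0 x0F.
pose g x := odflt i0 [pick i | f i == x].
have fg x : x \in F -> f (g x) = x.
  move=> /sF/imsetP[i _ xi]; rewrite /g; case: pickP => [j /eqP //|/(_ i)].
  by rewrite xi eqxx.
exists (g @: F); split; last exact: leq_imset_card.
apply/setP => x; apply/imsetP/idP => [[_ /imsetP[y yF ->] ->]|xF]; first by rewrite fg.
by exists (g x); [apply: imset_f | rewrite fg].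
Qed.

Lemma sparse_subconfiguration (X Lf : finType) (pts : Lf -> {set X}) k B r a T0
    (C : {set X} -> {set X}) :
    (forall l, #|pts l| = k) -> #|X| = k * B -> 0 < k -> 0 < B -> 0 < a -> 0 < T0 ->
    (forall F, 8 * (#|C F| + a) <= #|X|) ->
    (forall S : {set X}, (forall l, #|pts l :&: S| < r) ->
       exists F : {set X}, [/\ F \subset S, #|F| <= a & S \subset F :|: C F]) ->
    #|Lf| * 'C(64 * a, r.+1) <= a * B ^ r.+1 ->
    r * (#|Lf| * 'C(64 * a, r)) <= T0 * a * B ^ r ->
  exists (V : {set X}) (P : {set Lf}),
    [/\ forall l, l \in P -> r <= #|pts l :&: V|,
        forall x, x \in V ->
          #|[set y in V | (y != x) && [exists l in P, (x \in pts l) && (y \in pts l)]]|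
            <= T0 * r.-1 &
        forall c : X -> bool, exists2 l, l \in P &
          {in pts l :&: V &, forall x y, c x = c y}].
Proof.
move=> card_pts cardX k0 B0 a0 T00 C_small C_cont le2 le3.
(* The fingerprint is absorbed into its container; the value for large [F] makes the size bound hold
   for every argument. *)
pose C' (F : {set X}) := if #|F| <= a then F :|: C F else set0.
have C'_small F : 8 * #|C' F| <= #|X|.
  rewrite /C'; case: ifP => [Fa|]; last by rewrite cards0.
  apply: leq_trans (C_small F); rewrite leq_mul2l /=.
  by apply: leq_trans (leq_card_setU _ _) _; rewrite addnC leq_add2l.
have [v [D [degD lineD capD]]] :=
  good_sample card_pts cardX k0 B0 a0 T00 C'_small le2 le3.
pose V := v @: ~: D; pose P := [set l | r <= #|pts l :&: V|].
pose Jl l := [set i | (i \notin D) && (v i \in pts l)].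
have VJ l : pts l :&: V = v @: Jl l.
  apply/setP => x; rewrite inE; apply/andP/imsetP => [[xl /imsetP[i iD xi]]|[i]].
    by exists i => //; rewrite !inE -xi xl andbT; move: iD; rewrite inE.
  by rewrite inE => /andP[iD il] ->; split=> //; apply: imset_f; rewrite inE.
have Vr l : #|pts l :&: V| <= r.
  by rewrite VJ; apply: leq_trans (leq_imset_card _ _) (lineD l).
exists V, P; split=> [l|x /imsetP[i iD xi]|c].
- by rewrite inE.
- pose Px := [set l in P | x \in pts l].
  have cPx : #|Px| <= T0.
    (* For [l] in [P] the undeleted indices on [l] form a rich set of exactly [r] indices, so the
       lines of [P] through [x] inject into the sets counted by [pdeg]. *)
    apply: leq_trans (degD i _); last by move: iD; rewrite inE.
    rewrite -(@card_imset _ _ (fun l => (l, Jl l))); last by move=> l l' [].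
    apply/subset_leq_card/subsetP => _ /imsetP[l + ->]; rewrite !inE /= => /andP[lP xl].
    apply/andP; split; last by rewrite -xi xl andbT; move: iD; rewrite inE.
    apply/andP; split; last by apply/forall_inP => j; rewrite inE => /andP[].
    by rewrite eqn_leq lineD /=; apply: leq_trans lP _; rewrite VJ leq_imset_card.
  apply: (@leq_trans (#|\bigcup_(l in Px) ((pts l :&: V) :\ x)|)).
    apply/subset_leq_card/subsetP => y; rewrite inE => /and3P[yV yx /exists_inP[l lP /andP[xl yl]]].
    by apply/bigcupP; exists l; rewrite ?inE ?yx ?yl ?yV //; move: lP; rewrite inE => ->.
  apply: (@leq_trans (#|Px| * r.-1)); last by rewrite leq_mul2r cPx orbT.
  apply: card_bigcup_le => l; rewrite inE => /andP[_ xl].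
  have xV : x \in pts l :&: V by rewrite inE xl xi imset_f.
  by have := Vr l; rewrite (cardsD1 x) xV; case: (r).
pose S b := [set x in V | c x == b].
have SV b : S b \subset V by apply/subsetP => x; rewrite inE => /andP[].
(* A line has at most [r] points in [V], so [r] points of one colour exhaust it. If this never
   happens, both colour classes have fingerprints, and their containers capture all of [V]. *)
have [/existsP[[l b] /= lr]|/existsPn indep] :=
    boolP [exists p : Lf * bool, r <= #|pts p.1 :&: S p.2|].
  have sS : pts l :&: S b \subset pts l :&: V by apply: setIS.
  have lP : l \in P by rewrite inE (leq_trans lr) ?subset_leq_card.
  exists l => // x y; have /eqP <- : pts l :&: S b == pts l :&: V.
    by rewrite eqEcard sS (leq_trans (Vr l)).
  by rewrite !inE => /and3P[_ _ /eqP ->] /and3P[_ _ /eqP ->].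
have indep' b l : #|pts l :&: S b| < r by have := indep (l, b); rewrite -ltnNge.
have capture b : exists J : {set 'I_(64 * a)}, #|J| <= a /\ S b \subset C' (v @: J).
  have [F [FS Fa SF]] := C_cont (S b) (indep' b).
  have [J [JF JF']] := imset_preimage_card (subset_trans FS (SV b)).
  by exists J; rewrite JF /C' Fa; split=> //; apply: leq_trans Fa.
have [[J1 [J1a S1]] [J2 [J2a S2]]] := (capture true, capture false).
have [i iJ] := capD J1 J2 J1a J2a.
have iV : v i \in V by apply: imset_f; move: iJ; rewrite !inE !negb_or => /andP[/andP[]].
rewrite inE negb_or => /andP[i1 i2]; case ci: (c (v i)).
  by case/negP: i1; apply: (subsetP S1); rewrite inE iV ci.
by case/negP: i2; apply: (subsetP S2); rewrite inE iV ci.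
Qed.

(** * The grid hypergraph *)

Lemma sum_card_le (I J : finType) (P : {set I}) (Q : {set J}) (R : I -> J -> bool) :
  (forall i i' j, j \in Q -> R i j -> R i' j -> i = i') ->
  \sum_(i in P) #|[set j in Q | R i j]| <= #|Q|.
Proof.
move=> R1; rewrite (eq_bigr (fun i => \sum_(j in Q | R i j) 1)); last first.
  by move=> i _; rewrite sum1dep_card.
rewrite (exchange_big_dep (mem Q)) /=; last by move=> ? ? _ /andP[].
rewrite -sum1_card; apply: leq_sum => j jQ; rewrite sum1dep_card.
apply/card_le1_eqP => i i'; rewrite !inE => /and3P[_ _ Rij] /and3P[_ _ Ri'j].
exact: R1 jQ Ri'j Rij.
Qed.

(** Factor by factor, [216 * r - j <= 9 * (25 * r - j)] for [j < r]. *)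
Lemma bin_ratio r : 'C(216 * r, r) <= 'C(25 * r, r) * 9 ^ r.
Proof.
rewrite -(@leq_pmul2r r`!) ?fact_gt0 // mulnAC !bin_ffact.
suff: forall j, j <= r -> (216 * r) ^_ j <= (25 * r) ^_ j * 9 ^ j by apply.
elim=> [|j IH] jr; first by rewrite !ffactn0.
rewrite !ffactnSr expnSr mulnACA; apply: leq_mul; first by apply: IH; lia.
lia.
Qed.

Section Grid.
Variables (k B0 Dl r : nat).
Local Notation B := (B0 + k * Dl).
Local Notation X := ('I_k * 'I_B)%type.
Local Notation Lf := ('I_Dl * 'I_B0)%type.
Implicit Types (x y z : X) (l : Lf) (A e : {set X}).

Definition grid_line l : {set X} := [set x : X | (x.2 : nat) == l.1 * x.1 + l.2].

(** The extra [k * Dl] rows keep every line inside the grid across all [k] columns. *)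
Lemma grid_line_bound (s : 'I_Dl) (i : 'I_k) (t : 'I_B0) : s * i + t < B.
Proof. by case: s i t => s sD [i ik] [t tB] /=; nia. Qed.

Lemma card_grid_line l : #|grid_line l| = k.
Proof.
pose f (i : 'I_k) : X := (i, Ordinal (grid_line_bound l.1 i l.2)).
rewrite -[RHS](card_ord k) -cardsT -(@card_imset _ _ f); last by move=> i j [].
apply: eq_card => -[i b]; rewrite inE; apply/eqP/imsetP => [/= bE|[j _ [-> ->]]] //.
by exists i => //; congr pair; apply: val_inj.
Qed.

Lemma grid_line_inj l l' x y : x != y -> x \in grid_line l -> y \in grid_line l ->
  x \in grid_line l' -> y \in grid_line l' -> l = l'.
Proof.
case: l l' x y => [[s sD] [t tB]] [[s' sD'] [t' tB']] [[i ik] [b bB]] [[i' ik'] [b' bB']].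
rewrite !inE /= !xpair_eqE -!val_eqE /= => ne /eqP e1 /eqP e2 /eqP e3 /eqP e4.
have ne' : i <> i' by move=> ii; move: ne; rewrite ii eqxx e1 e2 ii eqxx.
have ss : s = s' by case: (ltngtP s s'); case: (ltngtP i i'); nia.
have tt : t = t' by nia.
by congr pair; apply: val_inj.
Qed.

Lemma grid_line_slope (s : 'I_Dl) (t t' : 'I_B0) x :
  x \in grid_line (s, t) -> x \in grid_line (s, t') -> t = t'.
Proof. by rewrite !inE /= => /eqP -> /eqP h; apply: val_inj => /=; lia. Qed.

Definition collinear_sets := [set e : {set X} | (#|e| == r) && [exists l, e \subset grid_line l]].

Lemma collinear_sets_card e : e \in collinear_sets -> #|e| = r.
Proof. by rewrite inE => /andP[/eqP]. Qed.

Lemma collinear_sets_codeg x y : x != y ->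
  #|[set z | [exists e in collinear_sets, [&& x \in e, y \in e & z \in e]]]| <= k.
Proof.
move=> xy; set Z := [set z | _].
have [->|[z]] := set_0Vmem Z; first by rewrite cards0.
rewrite inE => /existsP[e /and4P[]]; rewrite inE => /andP[_ /existsP[l /subsetP el]] /el xl /el yl _.
rewrite -[leqRHS](card_grid_line l); apply/subset_leq_card/subsetP => z'.
rewrite inE => /existsP[e' /and4P[]]; rewrite inE => /andP[_ /existsP[l' /subsetP el']].
by move=> /el' xl' /el' yl' /el'; rewrite (grid_line_inj xy xl yl xl' yl').
Qed.

(** At most one line of each slope passes through [x], and [r.-1] further points are chosen on
    it. *)
Lemma collinear_sets_deg x : 0 < r -> deg collinear_sets setT x <= Dl * 'C(k.-1, r.-1).
Proof.
move=> r0; pose F (s : 'I_Dl) :=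
  [set e : {set X} | [&& #|e| == r, x \in e & [exists t, e \subset grid_line (s, t)]]].
apply: (@leq_trans #|\bigcup_(s in 'I_Dl) F s|).
  apply/subset_leq_card/subsetP => e; rewrite inE => /andP[/edges_inP[]].
  rewrite inE => /andP[er /existsP[[s t] el]] _ xe.
  by apply/bigcupP; exists s => //; rewrite inE er xe; apply/existsP; exists t.
rewrite -[Dl in leqRHS](card_ord Dl); apply: card_bigcup_le => s _.
have [->|[e0]] := set_0Vmem (F s); first by rewrite cards0.
rewrite inE => /and3P[_ xe0 /existsP[t /subsetP/(_ x xe0) xt]].
have cl : #|grid_line (s, t) :\ x| = k.-1 
  by have := cardsD1 x (grid_line (s, t)); rewrite xt card_grid_line => /(congr1 predn).
rewrite -cl -cards_draws; apply: leq_trans (leq_imset_card (fun e => x |: e) _).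
apply/subset_leq_card/subsetP => e; rewrite inE => /and3P[/eqP er xe /existsP[t' et']].
have xt' := subsetP et' x xe; rewrite -(grid_line_slope xt xt') in et'.
apply/imsetP; exists (e :\ x); last by rewrite setD1K.
by rewrite inE setSD //=; have := cardsD1 x e; rewrite xe er => /(congr1 predn) /= ->.
Qed.

(** The lines of one slope are disjoint and miss only [k * (k * Dl)] points of the grid. *)
Lemma sum_card_grid_line A : Dl * #|A| <= \sum_(l : Lf) #|grid_line l :&: A| + Dl * (k * (k * Dl)).
Proof.
rewrite (_ : \sum_(l : Lf) _ = \sum_(s : 'I_Dl) \sum_(t : 'I_B0) #|grid_line (s, t) :&: A|); last first.
  by rewrite pair_big /=; apply: eq_bigr => -[s t].
have sum_cst c : Dl * c = \sum_(s : 'I_Dl) c by rewrite sum_nat_const card_ord.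
rewrite !sum_cst -big_split /=; apply: leq_sum => s _.
have cov : \sum_(t : 'I_B0) (#|grid_line (s, t) :&: A| + #|grid_line (s, t) :&: ~: A|) = B0 * k.
  rewrite (eq_bigr (fun => k)); first by rewrite sum_nat_const card_ord.
  by move=> t _; rewrite -[RHS](card_grid_line (s, t)) -(cardsID A (grid_line (s, t))) setDE.
have cC : \sum_(t : 'I_B0) #|grid_line (s, t) :&: ~: A| <= #|~: A|.
  have := @sum_card_le _ _ [set: 'I_B0] (~: A) (fun t x => x \in grid_line (s, t)) _.
  rewrite (eq_bigl xpredT); last by move=> t; rewrite inE.
  rewrite (eq_bigr (fun t => #|grid_line (s, t) :&: ~: A|)); last first.
    by move=> t _; rewrite setIC; apply: eq_card => x; rewrite !inE.
  by apply=> t t' x _; apply: grid_line_slope.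
have cT := cardsC A; rewrite card_prod !card_ord in cT.
rewrite big_split /= in cov.
move: cov cC cT; move: (\sum_t _) (\sum_t _) #|_| #|_| => u v c a; nia.
Qed.

(** Density 1/8 means [27 * r] points per line on average, of which the two error terms cost at most
    [r]. Lines with fewer than [25 * r] points account for at most 25 of the remaining 26 parts, so
    a fraction 1/216 of [Dl * B] lines are rich, each with a fraction [9 ^ -r] of its [r]-subsets
    inside [A]. *)
Lemma collinear_sets_supersat A a : k = 216 * r -> 1 < r -> k * (k * Dl) + a <= r * B ->
    #|{: X}| < 8 * (#|A| + a) ->
  #|{: X}| * (Dl * 'C(k.-1, r.-1)) <= #|edges_in collinear_sets A| * (216 * r * 9 ^ r).
Proof.
move=> kr r1 B_large; rewrite card_prod !card_ord => A_large.
pose M := [set l : Lf | 25 * r <= #|grid_line l :&: A|].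
have leM : \sum_(l : Lf) #|grid_line l :&: A| <= #|M| * k + Dl * B0 * (25 * r).
  rewrite (bigID (mem M)) /=; apply: leq_add.
    rewrite -sum_nat_const; apply: leq_sum => l _.
    by rewrite -[leqRHS](card_grid_line l) subset_leq_card // subsetIl.
  rewrite -[Dl in leqRHS]card_ord -[B0 in leqRHS]card_ord -card_prod -sum_nat_const big_mkcond /=.
  by apply: leq_sum => l _; rewrite inE -ltnNge; case: ifP => // /ltnW.
have M_large : Dl * B <= 216 * #|M|.
  have := sum_card_grid_line A; move: leM; move: (\sum_(l : Lf) _) #|M| #|A| A_large B_large => u c b.
  rewrite {1}kr => A_large B_large l1 l2.
  rewrite -(@leq_pmul2l r); last lia.
  have h1 : 27 * r * B <= b + a by lia.
  have := leq_mul (leqnn Dl) h1; have := leq_mul (leqnn Dl) B_large.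
  nia.
have leE : #|M| * 'C(25 * r, r) <= #|edges_in collinear_sets A|.
  apply: leq_trans (@sum_card_le _ _ M (edges_in collinear_sets A) (fun l e => e \subset grid_line l) _).
    rewrite -sum_nat_const; apply: leq_sum => l; rewrite inE => lM.
    apply: leq_trans (leq_bin2l r lM) _; rewrite -cards_draws.
    apply/subset_leq_card/subsetP => e; rewrite !inE subsetI => /andP[/andP[el eA] ->].
    by rewrite el eA !andbT /=; apply/existsP; exists l.
  move=> l l' e /edges_inP[/collinear_sets_card er _] /subsetP el /subsetP el'.
  have /card_gt1P[x [y [xe ye xy]]] : 1 < #|e| by rewrite er.
  by apply: (grid_line_inj xy); [exact: el | exact: el | exact: el' | exact: el'].
apply: (@leq_trans (#|M| * 'C(25 * r, r) * (216 * r * 9 ^ r))); last by rewrite leq_mul2r leE orbT.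
have -> : k * B * (Dl * 'C(k.-1, r.-1)) = (Dl * B) * (r * 'C(k, r)).
  have := mul_bin_diag k r.-1; rewrite prednK; last lia.
  by move=> <-; rewrite mulnACA mulnC mulnACA [Dl * _]mulnC -!mulnA; congr (_ * _); lia.
have -> : #|M| * 'C(25 * r, r) * (216 * r * 9 ^ r) = (216 * #|M|) * (r * ('C(25 * r, r) * 9 ^ r)).
  by move: ('C(_, _)) (9 ^ r) #|M| => c d M'; lia.
by apply: leq_mul => //; rewrite leq_mul2l kr bin_ratio orbT.
Qed.
End Grid.

(** * Choice of parameters *)

Lemma bin_fact_le_expn m j : 'C(m, j) * j`! <= m ^ j.
Proof.
rewrite bin_ffact; elim: j => [|j IH]; first by rewrite ffactn0.
by rewrite ffactnSr expnSr leq_mul // leq_subr.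
Qed.

Lemma bin_le_expn m j : 'C(m, j) <= m ^ j.
Proof. by apply: leq_trans (bin_fact_le_expn m j); rewrite leq_pmulr ?fact_gt0. Qed.

Lemma expn_le_ffact k j : 2 * j <= k -> k ^ j <= 2 ^ j * k.-1 ^_ j.
Proof.
elim: j => [|j IH] jk; first by rewrite ffactn0.
rewrite ffactnSr !expnSr mulnACA; apply: leq_mul; [apply: IH; lia | lia].
Qed.

Lemma muln_pos m n : 0 < m -> 0 < n -> 0 < m * n.
Proof. by rewrite muln_gt0 => -> ->. Qed.

Lemma count_rich s Dl K q H c1 B1 a N : 0 < K -> Dl * K = (4 * q) ^ s * H ->
  64 * 4 ^ s * H * c1 ^ s.+1 <= q -> 64 * a = c1 * B1 -> N <= Dl * (q * B1) ->
  N * 'C(64 * a, s.+2) <= a * (q * B1) ^ s.+2.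
Proof.
move=> K0 DK q_large ea leN; apply: leq_trans (leq_mul leN (bin_le_expn _ _)) _.
have key : 64 * Dl * (64 * a) ^ s.+1 <= (q * B1) ^ s.+1.
  rewrite ea !expnMn mulnA leq_mul2r; apply/orP; right.
  apply: (@leq_trans (64 * 4 ^ s * H * c1 ^ s.+1 * q ^ s)); last by rewrite (expnS q) leq_mul2r q_large orbT.
  have : Dl <= (4 * q) ^ s * H by rewrite -DK leq_pmulr.
  rewrite expnMn; move: (c1 ^ s.+1) (q ^ s) (4 ^ s) => u1 u2 u3 le1.
  have := leq_mul (leqnn (64 * u1)) le1; lia.
rewrite 2!(expnS _ s.+1); have := leq_mul (leqnn (a * (q * B1))) key.
by move: ((64 * a) ^ s.+1) ((q * B1) ^ s.+1) (q * B1) => u1 u2 u3; lia.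
Qed.

(** Here the powers of [q] cancel. The factorial from the binomial turns ['C(k.-1, s)] into a
    falling factorial comparable to [k ^ s]; the constant is 512 = 4 * 64 * 2, from [4 * q], the
    oversampling and [expn_le_ffact]. *)
Lemma count_edges s Dl k q H B1 a N : 2 * s <= k ->
  Dl * 'C(k.-1, s) = (4 * q) ^ s * H -> 0 < 'C(k.-1, s) ->
  64 * a = 64 * s * k * B1 -> N <= Dl * (q * B1) ->
  s.+1 * (N * 'C(64 * a, s.+1)) <= 64 * (512 * s) ^ s * H * a * (q * B1) ^ s.+1.
Proof.
move=> sk DK K0 ea leN; rewrite -(@leq_pmul2r s`!) ?fact_gt0 //.
have -> : s.+1 * (N * 'C(64 * a, s.+1)) * s`! = N * ('C(64 * a, s.+1) * (s.+1)`!).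
  by rewrite factS; move: ('C(_, _)) (_`!) => u1 u2; lia.
apply: leq_trans (leq_mul leN (bin_fact_le_expn _ _)) _.
set T0 := 64 * _ * H.
have key1 : 64 * Dl * (64 * s * k) ^ s <= T0 * q ^ s * s`!.
  rewrite -(@leq_pmul2r 'C(k.-1, s)) //.
  have -> : 64 * Dl * (64 * s * k) ^ s * 'C(k.-1, s) = 64 * (Dl * 'C(k.-1, s)) * (64 * s * k) ^ s.
    by move: ('C(_, _)) ((64 * s * k) ^ s) => u1 u2; lia.
  rewrite -[leqRHS]mulnA [s`! * _]mulnC bin_ffact DK /T0 !expnMn.
  have := expn_le_ffact sk.
  have -> : 512 ^ s = 4 ^ s * 64 ^ s * 2 ^ s by rewrite -!expnMn.
  move: (k ^ s) (_ ^_ s) (2 ^ s) (4 ^ s) (64 ^ s) (q ^ s) (s ^ s) => u1 u2 u3 u4 u5 u6 u7 le1.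
  have := leq_mul (leqnn (64 * u4 * u5 * u6 * u7 * H)) le1; lia.
have key : 64 * Dl * (64 * a) ^ s <= T0 * (q * B1) ^ s * s`!.
  rewrite ea !(expnMn _ B1); have := leq_mul key1 (leqnn (B1 ^ s)).
  by move: ((64 * s * k) ^ s) (B1 ^ s) (q ^ s) (s`!) (T0) => u1 u2 u3 u4 u5; lia.
rewrite !(expnS _ s); have := leq_mul (leqnn (a * (q * B1))) key.
by move: ((64 * a) ^ s) ((q * B1) ^ s) (q * B1) (s`!) (T0) => u1 u2 u3 u4 u5; lia.
Qed.

Section GridChoice.
Variable r : nat.
Hypothesis r_gt2 : 2 < r.

(* [h j] bounds the inverse edge density on level [j] of the container argument,
   [D j] the degrees there.  The slope count [Dl] is such that a grid point has
   degree [Dl * K = D 0] among the collinear [r]-sets, and [a] is the size of a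
   fingerprint, which the sample exceeds by a factor of 64.  [q] is the free
   large parameter: [T0] bounds the degrees in the sample independently of it. *)
Let k := 216 * r.
Let h0 := 216 * r * 9 ^ r.
Let h j := (4 * r.-1) ^ j * h0.
Let H := \prod_(0 <= j < r.-1) h j.
Let c1 := 64 * r.-1 * k.
Let K := 'C(k.-1, r.-1).
Let q1 := 64 * 4 ^ r.-1 * H * c1 ^ r.
Let q2 := q1 * (2 * 2 ^ k).
Let q := K * q2.
Let D j := \prod_(j <= i < r.-1) (4 * h i * q).
Let Dl := 4 * h0 * q2 * D 1.
Let B1 := k * k * Dl.
Let B := q * B1.
Let a := r.-1 * k * B1.
Let T0 := 64 * (512 * r.-1) ^ r.-1 * H.

Lemma par_k_gt0 : 0 < k. Proof. by rewrite /k; lia. Qed.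
Lemma par_h0_gt0 : 0 < h0. Proof. by rewrite /h0 !muln_gt0 expn_gt0; lia. Qed.
Lemma par_h_gt0 j : 0 < h j.
Proof. by apply: muln_pos par_h0_gt0; rewrite expn_gt0; lia. Qed.
Lemma par_H_gt0 : 0 < H.
Proof. by rewrite /H; apply: prodn_gt0 => j; apply: par_h_gt0. Qed.
Lemma par_K_gt0 : 0 < K.
Proof. by rewrite /K bin_gt0 /k; lia. Qed.
Lemma par_c1_gt0 : 0 < c1.
Proof. by apply: muln_pos par_k_gt0; lia. Qed.
Lemma par_q1_gt0 : 0 < q1.
Proof.
apply: muln_pos; last by rewrite expn_gt0 par_c1_gt0.
by apply: muln_pos par_H_gt0; rewrite muln_gt0 expn_gt0.
Qed.
Lemma par_q2_gt0 : 0 < q2.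
Proof. by apply: muln_pos par_q1_gt0 _; rewrite muln_gt0 expn_gt0. Qed.
Lemma par_q1_le : q1 <= q.
Proof.
by rewrite /q /q2 mulnCA leq_pmulr //; apply: muln_pos par_K_gt0 _; rewrite muln_gt0 expn_gt0.
Qed.
Lemma par_q_large : 2 * 2 ^ k <= q.
Proof. by rewrite /q /q2 mulnA leq_pmull //; apply: muln_pos par_K_gt0 par_q1_gt0. Qed.
Lemma par_k_le_q : k <= q.
Proof.
apply: leq_trans par_q_large; apply: leq_trans (ltnW (ltn_expl k (isT : 1 < 2))) _.
by rewrite leq_pmull.
Qed.
Lemma par_q_gt0 : 0 < q.
Proof. by apply: leq_trans par_k_le_q; apply: par_k_gt0. Qed.

Lemma par_D_last : D r.-1 = 1. Proof. by rewrite /D big_geq. Qed.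
Lemma par_D_rec j : j < r.-1 -> D j = 4 * h j * q * D j.+1.
Proof. by move=> jr; rewrite /D big_ltn. Qed.
Lemma par_D_gt0 j : 0 < D j.
Proof. by apply: prodn_gt0 => i; apply: muln_pos par_q_gt0; apply: muln_pos (par_h_gt0 i). Qed.
(** [q] is a multiple of [K] so that this holds exactly. *)
Lemma par_D0 : D 0 = Dl * K.
Proof.
rewrite par_D_rec; last lia.
by rewrite /Dl /q /h expn0 mul1n; move: (D 1) => d; lia.
Qed.
Lemma par_D0_prod : Dl * K = (4 * q) ^ r.-1 * H.
Proof.
rewrite -par_D0 /D /H (eq_bigr (fun i => (4 * q) * h i)); last by move=> i _; lia.
by rewrite big_split /= prod_nat_const_nat subn0.
Qed.
Lemma par_Dl_gt0 : 0 < Dl.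
Proof. by apply: muln_pos (par_D_gt0 1); apply: muln_pos par_q2_gt0; apply: muln_pos par_h0_gt0. Qed.
Lemma par_B1_gt0 : 0 < B1.
Proof. by apply: muln_pos par_Dl_gt0; apply: muln_pos par_k_gt0 par_k_gt0. Qed.
Lemma par_B_gt0 : 0 < B.
Proof. exact: muln_pos par_q_gt0 par_B1_gt0. Qed.
Lemma par_a_gt0 : 0 < a.
Proof. by apply: muln_pos par_B1_gt0; apply: muln_pos par_k_gt0; lia. Qed.
Lemma par_T0_gt0 : 0 < T0.
Proof. by apply: muln_pos par_H_gt0; rewrite muln_gt0 expn_gt0; lia. Qed.
Lemma par_kDl_le : k * Dl <= B.
Proof.
rewrite /B /B1 -mulnA mulnCA leq_mul2l; apply/orP; right.
by rewrite mulnA leq_pmull //; apply: muln_pos par_q_gt0 par_k_gt0.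
Qed.
Lemma par_B_large : k * (k * Dl) + a <= r * B.
Proof.
have l1 : k * (k * Dl) <= B by rewrite mulnA -/B1 /B leq_pmull // par_q_gt0.
have l2 : a <= r.-1 * B.
  by rewrite /a -mulnA leq_mul2l /B leq_mul2r par_k_le_q !orbT.
apply: leq_trans (leq_add l1 l2) _.
by rewrite -mulSn prednK //; lia.
Qed.
Lemma par_64a : 64 * a = c1 * B1.
Proof. by rewrite /a /c1 !mulnA. Qed.

Lemma par_count2 N : N <= Dl * B -> N * 'C(64 * a, r.+1) <= a * B ^ r.+1.
Proof.
have rr : r = r.-1.+1 by rewrite prednK //; lia.
rewrite [in r.+1]rr; apply: (@count_rich r.-1 Dl K q H c1 B1 a N) par_K_gt0 par_D0_prod _ par_64a.
by rewrite -rr; apply: par_q1_le.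
Qed.

Lemma par_count3 N : N <= Dl * B -> r * (N * 'C(64 * a, r)) <= T0 * a * B ^ r.
Proof.
have rr : r = r.-1.+1 by rewrite prednK //; lia.
have kr : 2 * r.-1 <= k by rewrite /k; lia.
have := @count_edges r.-1 Dl k q H B1 a N kr par_D0_prod par_K_gt0 par_64a.
by rewrite -rr.
Qed.

(** The exponents add up to [3 * r ^ 2 + 8 * r - 6], which is at most [5 * r ^ 2] because
    [(r - 1) * (r - 3) >= 0], with equality at [r = 3]. *)
Lemma par_T0_le : T0 * r.-1 <= r ^ (5 * r ^ 2).
Proof.
have r1 : 0 < r by lia.
have e1 : 64 <= r ^ 4 by apply: (@leq_trans (3 ^ 4)) => //; apply: leq_expl.
have e2 : 512 * r.-1 <= r ^ 7.
  rewrite [r ^ 7]expnSr; apply: leq_mul; last lia.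
  by apply: (@leq_trans (3 ^ 6)); [lia | apply: leq_expl].
have e3 : h0 <= r ^ (2 * r + 6).
  have : 9 ^ r <= (r ^ 2) ^ r by apply: leq_expl; apply: (@leq_trans (3 ^ 2)) => //; apply: leq_expl.
  rewrite -expnM => e9.
  have e216 : 216 <= r ^ 5 by apply: (@leq_trans (3 ^ 5)); [lia | apply: leq_expl].
  rewrite /h0 (_ : 2 * r + 6 = 5 + 1 + 2 * r); last lia.
  by rewrite (expnD r (5 + 1)) (expnD r 5) expn1; apply: leq_mul e9; apply: leq_mul.
have e4 : H <= r ^ ((r.-1 * r.-2) + (2 * r + 6) * r.-1).
  have : H <= \prod_(0 <= j < r.-1) (r ^ (2 * j) * r ^ (2 * r + 6)).
    apply: leq_prod => j _; rewrite /h; apply: leq_mul e3; rewrite expnM; apply: leq_expl.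
    by move: r_gt2; clear; nia.
  move=> /leq_trans; apply; rewrite big_split /= prod_nat_const_nat subn0 -expnM -expn_sum (expnD r (r.-1 * r.-2)).
  rewrite leq_mul2r leq_pexp2l ?orbT //.
  rewrite -big_distrr /= bin2_sum bin2; clear; lia.
have -> : T0 * r.-1 = 64 * (512 * r.-1) ^ r.-1 * H * r.-1 by [].
apply: (@leq_trans (r ^ 4 * (r ^ 7) ^ r.-1 * r ^ (r.-1 * r.-2 + (2 * r + 6) * r.-1) * r)).
  by apply: leq_mul (leq_pred r); apply: leq_mul e4; apply: leq_mul e1 _; apply: leq_expl.
rewrite -expnM -!expnD -expnSr leq_pexp2l //.
by move: r_gt2; clear; case: r => // -[//|[//|s]] _ /=; nia.
Qed.

Lemma unsplittable_grid : exists k B0 Dl (V : {set 'I_k * 'I_(B0 + k * Dl)})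
    (P : {set 'I_Dl * 'I_B0}),
  [/\ forall l, l \in P -> r <= #|grid_line k l :&: V|,
      forall x, x \in V ->
        #|[set y in V | (y != x) && [exists l in P, (x \in grid_line k l) && (y \in grid_line k l)]]|
          <= r ^ (5 * r ^ 2) &
      forall c : 'I_k * 'I_(B0 + k * Dl) -> bool, exists2 l, l \in P &
        {in grid_line k l :&: V &, forall x y, c x = c y}].
Proof.
pose B0 := B - k * Dl; have eB : B0 + k * Dl = B by rewrite subnK ?par_kDl_le.
pose X : finType := ('I_k * 'I_(B0 + k * Dl))%type.
have cX : #|X| = k * B by rewrite card_prod !card_ord eB.
have cLf : #|{: 'I_Dl * 'I_B0}| <= Dl * B.
  by rewrite card_prod !card_ord leq_mul2l leq_subr orbT.
have r1 : 1 < r by lia.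
have r0 : 0 < r by lia.
have h00 : h 0 = h0 by rewrite /h expn0 mul1n.
have X0 : 0 < #|X| by rewrite cX; apply: muln_pos par_k_gt0 par_B_gt0.
pose th j := q * D j.+1.
have [|||||||||C C1 C2] :=
  @containers X (collinear_sets k B0 Dl r) r k D th h r1 _ _ _ par_D_last _ _ _ _ _ _ X0.
- exact: collinear_sets_card.
- by move=> x; rewrite par_D0; apply: collinear_sets_deg.
- exact: collinear_sets_codeg.
- by move=> j _; apply: par_h_gt0.
- by move=> j _; apply: muln_pos par_q_gt0 (par_D_gt0 _).
- by move=> j jr; rewrite (par_D_rec jr) /th mulnA.
- by move=> j jr; rewrite (par_D_rec jr) mulnA leq_mul2r leq_mul2l par_k_le_q !orbT.
- by move=> j _; rewrite /h expnS mulnA.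
- move=> i /andP[_ ir]; apply: leq_trans par_q_large _; rewrite (par_D_rec ir) mulnAC.
  by rewrite leq_pmull //; apply: muln_pos (par_D_gt0 _); apply: muln_pos (par_h_gt0 _).
have C_small F : 8 * (#|C F| + a) <= #|X|.
  rewrite leqNgt; apply/negP => big; have := C1 F; rewrite ltnNge => /negP[].
  by rewrite par_D0 h00; apply: (collinear_sets_supersat _ _ _ big); rewrite ?eB // par_B_large.
have [S SI|V [P [VP1 VP2 VP3]]] := sparse_subconfiguration (@card_grid_line k B0 Dl) cX par_k_gt0
    par_B_gt0 par_a_gt0 par_T0_gt0 C_small _ (par_count2 cLf) (par_count3 cLf).
  have [e|F [FS Fa SF]] := C2 S.
    rewrite inE => /andP[/eqP er /existsP[l el]]; apply/negP => eS.
    have := SI l; rewrite ltnNge => /negP[]; rewrite -er.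
    by apply: subset_leq_card; rewrite subsetI el.
  exists F; split=> //; apply: leq_trans Fa _.
  (* With [th j = q * D j.+1] each of the [r.-1] summands is [#|X| / q = k * B1], which gives
     exactly [a]. *)
  rewrite (eq_bigr (fun => k * B1)); first by rewrite sum_nat_const card_ord /a mulnA.
  move=> j _; rewrite /th divnMr ?par_D_gt0 // cX /B mulnCA mulKn //.
  exact: par_q_gt0.
exists k, B0, Dl, V, P; split=> // x xV.
exact: leq_trans (VP2 x xV) par_T0_le.
Qed.
End GridChoice.

(** * Realization by lines in the plane *)

(** Duality: the grid line of slope [p.1] and intercept [p.2] becomes the point [p], and the grid
    point [v] becomes the line [v.1 * x + y = v.2]. *)
Definition incid (p v : nat * nat) := v.1 * p.1 + p.2 == v.2.
Definition rpoint (p : nat * nat) : point := (INR p.1, INR p.2).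
Definition rline (v : nat * nat) : line :=
  fun z => Rplus (Rmult (INR v.1) (Datatypes.fst z)) (Datatypes.snd z) = INR v.2.

Lemma InP (T : eqType) (s : seq T) x : reflect (In x s) (x \in s).
Proof.
elim: s => [|y s IH]; first by apply: ReflectF.
rewrite inE; apply: (iffP orP) => [[/eqP ->|/IH]|[->|/IH]]; rewrite ?eqxx; auto; first by left.
by right.
Qed.

Lemma uniq_map_NoDup (T : eqType) U (f : T -> U) (s : seq T) :
  injective f -> uniq s -> NoDup (map f s).
Proof.
move=> f_inj; elim: s => [|x s IH] /=; first by constructor.
move=> /andP[xs us]; constructor; last exact: IH.
by move=> /in_map_iff[y [/f_inj -> /InP]]; rewrite (negbTE xs).
Qed.

Lemma rlineP p v : rline v (rpoint p) <-> incid p v.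
Proof.
rewrite /rline /rpoint /= -mult_INR -plus_INR; split.
  by move=> /INR_eq e; apply/eqP.
by move=> /eqP <-.
Qed.

Lemma rpoint_inj : injective rpoint.
Proof. by move=> [a b] [c d] [/INR_eq -> /INR_eq ->]. Qed.

Lemma rline_inj : injective rline.
Proof.
move=> v w vw.
have on z : rline v z -> rline w z by rewrite vw.
have /on e2 : rline v (IZR 0, INR v.2) by rewrite /rline /=; lra.
have /on e1 : rline v (IZR 1, Rminus (INR v.2) (INR v.1)) by rewrite /rline /=; lra.
rewrite /rline /= in e1 e2.
have /INR_eq v2 : INR v.2 = INR w.2 by lra.
have /INR_eq v1 : INR v.1 = INR w.1 by lra.
by rewrite [v]surjective_pairing [w]surjective_pairing v1 v2.
Qed.

Lemma rline_is_line v : is_line (rline v).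
Proof.
exists (INR v.1), (IZR 1), (INR v.2); split=> [|z]; first by right; lra.
by rewrite /rline; split => e; lra.
Qed.

Lemma realization (V P : seq (nat * nat)) r T :
    uniq V -> uniq P ->
    {in P, forall p, r <= count (incid p) V} ->
    {in V, forall v, count [pred w | (w != v) && has (fun p => incid p v && incid p w) P] V <= T} ->
    (forall c : nat * nat -> bool, exists2 p, p \in P &
       {in V &, forall v w, incid p v -> incid p w -> c v = c w}) ->
  exists (P : list point) (L : list line),
    NoDup P /\ NoDup L /\ Forall is_line L /\
    (forall p, In p P -> on_at_least L p r) /\
    (forall l, In l L -> meets_at_most P L l T) /\
    ~ decomposable P L.
Proof.
move=> uV uP rich sparse mono.
exists (map rpoint P), (map rline V).
split; first exact: uniq_map_NoDup rpoint_inj uP.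
split; first exact: uniq_map_NoDup rline_inj uV.
split; first by apply/Forall_map/Forall_forall => v _; apply: rline_is_line.
split=> [_ /in_map_iff[p [<- /InP pP]]|].
  exists (map rline (filter (incid p) V)); split; last split; last split.
  - by apply: uniq_map_NoDup rline_inj _; apply: filter_uniq.
  - move=> _ /in_map_iff[v [<- /InP]]; rewrite mem_filter => /andP[_ vV].
    by apply/in_map/InP.
  - apply/leP; rewrite -[List.length _]/(size _) size_map size_filter; exact: rich.
  - apply/Forall_map/Forall_forall => v /InP; rewrite mem_filter => /andP[pv _].
    exact/rlineP.
split=> [_ /in_map_iff[v [<- /InP vV]] S uS SV meetS|[c dec]].
  apply/leP; apply: leq_trans (sparse v vV).
  set Q := [pred w | _]; rewrite -size_filter -(size_map rline); apply/leP.
  apply: NoDup_incl_length => // l lS.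
  have /in_map_iff[w [wl /InP wV]] := SV l lS.
  have [lv [_ [/in_map_iff[p [<- /InP pP]] [pv pl]]]] := meetS l lS.
  rewrite -wl; apply/in_map/InP; rewrite mem_filter wV andbT /=; apply/andP; split.
    by apply/eqP => wv; apply: lv; rewrite -wl wv.
  by apply/hasP; exists p => //; apply/andP; split; apply/rlineP => //; rewrite wl.
have [p pP pmono] := mono (fun v => c (rline v)).
have [[l1 [+ [+ +]]] [l2 [+ [+ +]]]] := dec (rpoint p) (in_map rpoint _ _ (elimT (InP _ _) pP)).
move=> /in_map_iff[v [<- /InP vV]] /rlineP pv cv /in_map_iff[w [<- /InP wV]] /rlineP pw cw.
by have := pmono v w vV wV pv pw; rewrite cv cw.
Qed.

Lemma pow_expn m n : Nat.pow m n = m ^ n.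
Proof. by elim: n => //= n ->; rewrite expnS. Qed.

Lemma count_enum (T : finType) (A : {set T}) (a : pred T) :
  count a (enum A) = #|[set x in A | a x]|.
Proof. by rewrite -sum1_count big_enum_cond sum1dep_card. Qed.

Lemma indecomposable_lines r : (1 <= r)%coq_nat ->
  exists (P : list point) (L : list line),
    NoDup P /\ NoDup L /\ Forall is_line L /\
    (forall p, In p P -> on_at_least L p r) /\
    (forall l, In l L -> meets_at_most P L l (Nat.pow r (Nat.mul 5 (Nat.pow r 2)))) /\
    ~ decomposable P L.
Proof.
rewrite !pow_expn => /leP; case: r => [//|[_|[_|r _]]].
(* For [r = 1] a single point on a single line suffices. *)
- apply: (@realization [:: (0, 0)] [:: (0, 0)]) => //.
  + by move=> p; rewrite inE => /eqP ->.
  + by move=> v; rewrite inE => /eqP ->.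
  by move=> c; exists (0, 0) => // v w; rewrite !inE => /eqP -> /eqP ->.
(* For [r = 2] a triangle: two of its three lines share a colour, and their intersection point is
   monochromatic. *)
- apply: (@realization [:: (0, 2); (1, 3); (2, 6)] [:: (1, 2); (2, 2); (3, 0)]) => //.
  + by move=> p; rewrite !inE => /or3P[] /eqP ->.
  + move=> v _; apply: leq_trans (count_size _ _) _.
    by apply: (@leq_trans (2 ^ 2)) => //; rewrite leq_pexp2l.
  move=> c; have [e|[e|e]] : c (0, 2) = c (1, 3) \/ c (0, 2) = c (2, 6) \/ c (1, 3) = c (2, 6).
  + by case: (c (0, 2)); case: (c (1, 3)); case: (c (2, 6)); auto.
  + by exists (1, 2) => // v w; rewrite !inE => /or3P[] /eqP -> /or3P[] /eqP -> //; rewrite e.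
  + by exists (2, 2) => // v w; rewrite !inE => /or3P[] /eqP -> /or3P[] /eqP -> //; rewrite e.
  by exists (3, 0) => // v w; rewrite !inE => /or3P[] /eqP -> /or3P[] /eqP -> //; rewrite e.
have [k [B0 [Dl [V [P [rich sparse mono]]]]]] := @unsplittable_grid r.+3 isT.
pose fv (x : 'I_k * 'I_(B0 + k * Dl)) := (x.1 : nat, x.2 : nat).
pose fp (l : 'I_Dl * 'I_B0) := (l.1 : nat, l.2 : nat).
have fv_inj : injective fv by move=> [i b] [i' b'] [/val_inj -> /val_inj ->].
have fp_inj : injective fp by move=> [i b] [i' b'] [/val_inj -> /val_inj ->].
have incE l x : incid (fp l) (fv x) = (x \in grid_line k l).
  by rewrite inE eq_sym /incid /= mulnC.
apply: (@realization (map fv (enum V)) (map fp (enum P))).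
- by rewrite map_inj_uniq ?enum_uniq.
- by rewrite map_inj_uniq ?enum_uniq.
- move=> _ /mapP[l + ->]; rewrite mem_enum => lP; rewrite count_map count_enum.
  apply: leq_trans (rich l lP) _; apply/subset_leq_card/subsetP => x.
  by rewrite [in X in _ -> X]inE /= incE inE andbC.
- move=> _ /mapP[x + ->]; rewrite mem_enum => xV; rewrite count_map count_enum.
  apply: leq_trans (sparse x xV); apply/subset_leq_card/subsetP => y.
  rewrite [in X in X -> _]inE /= => /and3P[yV yx /hasP[_ /mapP[l + ->]]].
  rewrite mem_enum !incE => lP xy; rewrite inE yV; apply/andP; split => //.
  apply/andP; split; first by apply: contraNneq yx => ->.
  by apply/exists_inP; exists l.
move=> c; have [l lP lmono] := mono (c \o fv).
exists (fp l); first by apply: map_f; rewrite mem_enum.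
move=> _ _ /mapP[x + ->] /mapP[y + ->]; rewrite !mem_enum !incE => xV yV xl yl.
by apply: lmono; rewrite inE ?xl ?yl.
Qed.
End IndecomposableLines.

Theorem theorem2p5 (r : nat) (hr : (1 <= r)%nat) :
  exists (P : list point) (L : list line),
    NoDup P /\ NoDup L /\ Forall is_line L /\
    (forall p, In p P -> on_at_least L p r) /\
    (forall l, In l L -> meets_at_most P L l (r ^ (5 * r ^ 2))) /\
    ~ decomposable P L.
Proof.
exact (IndecomposableLines.indecomposable_lines hr).
Qed.
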